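(* Let $R$ be a $\Delta U$ ring, i.e. $U(R)=1+\Delta(R)$, and let $\bar R=R/J(R)$. Then: (1) For any $u_1,u_2\in U(R)$, $u_1+u_2\neq 1$. (2) For any $\bar u_1,\bar u_2\in U(\bar R)$, $\bar u_1+\bar u_2\neq \bar 1$.
   Context: Rings are associative with identity, not necessarily commutative. $U(R)$ is the group of units of $R$ and $J(R)$ the Jacobson radical. $\Delta(R)=\{r\in R : r+U(R)\subseteq U(R)\}$. A ring $R$ is called $\Delta U$ if $U(R)=1+\Delta(R)$. *)

(* Defs.v *)
From HB Require Import structures.
From mathcomp Require Import all_boot all_order all_algebra.
From mathcomp Require Import boolp classical_sets.

Set Implicit Arguments.
Unset Strict Implicit.
Unset Printing Implicit Defensive.

Import GRing.Theory.
Local Open Scope classical_set_scope.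
Local Open Scope quotient_scope.
Local Open Scope ring_scope.

(* [GRing.unit] presupposes a [unitRingType] structure, which an arbitrary ring
   does not carry, so units are the elements with a two-sided inverse. *)
Definition units (R : pzRingType) : set R :=
  [set u | exists v, u * v = 1 /\ v * u = 1].
Arguments units : clear implicits.

Definition Delta (R : pzRingType) : set R :=
  [set r : R | [set r + u | u in units R] `<=` units R].
Arguments Delta : clear implicits.

Definition DeltaU (R : pzRingType) : Prop :=
  units R = [set 1 + r | r in Delta R].

Section Jacobson.
Variable R : nzRingType.
Implicit Types (M N : {pred R}) (x y a r : R).

(* [idealr_closed M] asks for closure under [a * u + v] and for [1 \notin M]:
   despite its name, it says that M is a proper left ideal. *)
Definition maximal_left_ideal M : Prop :=
  idealr_closed M /\
  forall N, idealr_closed N -> {subset M <= N} -> {subset N <= M}.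

Definition jacobson : {pred R} :=
  [pred x | `[< forall M, maximal_left_ideal M -> x \in M >]].

Lemma jacobsonP x :
  reflect (forall M, maximal_left_ideal M -> x \in M) (x \in jacobson).
Proof. exact: asboolP. Qed.

Lemma idealr_closedZ M a x : idealr_closed M -> x \in M -> a * x \in M.
Proof. by case=> M0 _ Ml xM; rewrite -[a * x]addr0 Ml. Qed.

Lemma idealr_closedD M x y :
  idealr_closed M -> x \in M -> y \in M -> x + y \in M.
Proof. by case=> _ _ Ml xM yM; rewrite -[x]mul1r Ml. Qed.

Fact jacobson_zmod_closed : zmod_closed jacobson.
Proof.
split=> [|x y /jacobsonP xJ /jacobsonP yJ].
  by apply/jacobsonP => M [[]].
apply/jacobsonP => M maxM.
by have [_] := idealr_closedB maxM.1; apply; [apply: xJ|apply: yJ].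
Qed.

HB.instance Definition _ :=
  GRing.isZmodClosed.Build R jacobson jacobson_zmod_closed.

Lemma jacobsonMl a x : x \in jacobson -> a * x \in jacobson.
Proof.
move=> /jacobsonP xJ; apply/jacobsonP => M maxM.
by apply: idealr_closedZ (xJ _ maxM); exact: maxM.1.
Qed.

Lemma maximal_left_ideal_transporter M r :
  maximal_left_ideal M -> r \notin M ->
  maximal_left_ideal [pred y | y * r \in M].
Proof.
move=> [idM maxM] rM; have [M0 M1 Ml] := idM; split.
  split; rewrite ?inE ?mul0r ?mul1r // => a u v; rewrite !inE => uM vM.
  by rewrite mulrDl -mulrA Ml.
move=> N idN sN y yN; rewrite inE; have [_ N1 Nl] := idN.
apply: contraT => yrM.
pose M' : {pred R} :=
  [pred z | `[< exists m a, m \in M /\ z = m + a * (y * r) >]].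
have sMM' : {subset M <= M'}.
  by move=> m mM; apply/asboolP; exists m, 0; rewrite mul0r addr0.
have yrM' : y * r \in M' by apply/asboolP; exists 0, 1; rewrite mul1r add0r.
have [/asboolP [m [a [mM e]]]|M'1] := boolP (1 \in M').
  have : 1 - r * a * y \in N.
    apply: sN; rewrite inE mulrBl mul1r -!mulrA.
    have -> : r - r * (a * (y * r)) = r * m.
      by rewrite -{1}[r]mulr1 e mulrDr addrK.
    exact: idealr_closedZ.
  move=> h; have := Nl (r * a) y _ yN h.
  by rewrite addrC subrK (negPf N1).
have idM' : idealr_closed M'.
  split=> //; first exact: sMM'.
  move=> c u v /asboolP [m [a [mM ->]]] /asboolP [m' [a' [m'M ->]]].
  apply/asboolP; exists (c * m + m'), (c * a + a'); split; first exact: Ml.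
  by rewrite mulrDr mulrDl -mulrA addrACA.
by rewrite (maxM _ idM' sMM' _ yrM') in yrM.
Qed.

Lemma jacobsonMr x r : x \in jacobson -> x * r \in jacobson.
Proof.
move=> /jacobsonP xJ; apply/jacobsonP => M maxM.
have [rM|rM] := boolP (r \in M).
  by apply: idealr_closedZ rM; exact: maxM.1.
by have := xJ _ (maximal_left_ideal_transporter maxM rM).
Qed.

Lemma exists_maximal_left_ideal : exists M, maximal_left_ideal M.
Proof.
pose P (A : set R) := A !=set0 -> idealr_closed (mem A).
have [F FP Ftot|A [PA maxA]] := @Zorn_bigcup R P.
  move=> [x0 [A0 FA0 A0x0]].
  have idF A x : F A -> A x -> idealr_closed (mem A).
    by move=> FA Ax; apply: (FP A FA); exists x.
  split.
  - apply/mem_set; exists A0 => //; apply: set_mem.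
    by have [] := idF _ _ FA0 A0x0.
  - apply/negP => /set_mem [A FA A1].
    by have [_ /negP[]] := idF _ _ FA A1; apply/mem_set.
  - move=> a u v /set_mem [A FA Au] /set_mem [B FB Bv]; apply/mem_set.
    have [AB|BA] := Ftot _ _ FA FB.
    + exists B => //; apply: set_mem.
      by have [_ _] := idF _ _ FB Bv; apply; apply/mem_set => //; apply: AB.
    + exists A => //; apply: set_mem.
      by have [_ _] := idF _ _ FA Au; apply; apply/mem_set => //; apply: BA.
have id0 : idealr_closed (mem [set (0 : R)]).
  split; first exact/mem_set.
    by apply/negP => /set_mem /= /eqP; rewrite oner_eq0.
  by move=> a u v /set_mem -> /set_mem ->; apply/mem_set; rewrite /= mulr0 addr0.
have A0 : A !=set0.
  apply: contrapT => nA; apply: (maxA [set 0]); last by move=> _; exact: id0.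
  split=> [x Ax|s]; first by case: nA; exists x.
  by apply: nA; exists 0; apply: s.
exists (fun x => x \in A); split; first exact: PA.
move=> N idN sAN x xN; apply: contraT => xA.
case: (maxA [set` N]).
  split=> [y Ay|s]; first by apply: sAN; apply/mem_set.
  by move/negP: xA; case; apply/mem_set; apply: s.
move=> _; have [N0 N1 Nl] := idN; split.
- exact/mem_set.
- by apply/negP => /set_mem /=; exact/negP.
- by move=> a u v /set_mem uN /set_mem vN; apply/mem_set; exact: Nl.
Qed.

Lemma jacobson1 : 1 \notin jacobson.
Proof.
apply/negP => /jacobsonP h; have [M maxM] := exists_maximal_left_ideal.
by have := h M maxM; case: maxM => -[_ /negP].
Qed.

(* The library equips [{ideal_quot I}] with a multiplication only when R is
   commutative; it is the additive group R / J(R) in general. *)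
Definition quot_jacobson : Type := {ideal_quot jacobson}.

HB.instance Definition _ := Choice.on quot_jacobson.
HB.instance Definition _ := GRing.Zmodule.on quot_jacobson.
HB.instance Definition _ := ZmodQuotient.on quot_jacobson.

Let one : quot_jacobson := lift_cst quot_jacobson 1.
Let mul := lift_op2 quot_jacobson *%R.

Let pi_one : \pi_quot_jacobson 1 = one.
Proof. by rewrite /one; unlock. Qed.

Let pi_mul : {morph \pi_quot_jacobson : x y / x * y >-> mul x y}.
Proof.
move=> x y; rewrite /mul; unlock; apply/eqP; rewrite -Quotient.idealrBE.
set x' := repr _; set y' := repr _.
have xJ : x - x' \in jacobson by rewrite Quotient.idealrBE reprK.
have yJ : y - y' \in jacobson by rewrite Quotient.idealrBE reprK.
have -> : x * y - x' * y' = (x - x') * y + x' * (y - y').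
  by rewrite mulrBl mulrBr addrA subrK.
by apply: rpredD; [exact: jacobsonMr|exact: jacobsonMl].
Qed.

Let mulqA : associative mul.
Proof.
move=> x y z; rewrite -[x]reprK -[y]reprK -[z]reprK.
by rewrite -!pi_mul mulrA.
Qed.

Let mul1q : left_id one mul.
Proof. by move=> x; rewrite -[x]reprK -pi_one -pi_mul mul1r. Qed.

Let mulq1 : right_id one mul.
Proof. by move=> x; rewrite -[x]reprK -pi_one -pi_mul mulr1. Qed.

Let mulqDl : left_distributive mul +%R.
Proof.
move=> x y z; rewrite -[x]reprK -[y]reprK -[z]reprK.
by rewrite -pi_addr -!pi_mul -pi_addr mulrDl.
Qed.

Let mulqDr : right_distributive mul +%R.
Proof.
move=> x y z; rewrite -[x]reprK -[y]reprK -[z]reprK.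
by rewrite -pi_addr -!pi_mul -pi_addr mulrDr.
Qed.

Let nonzero1q : one != 0.
Proof.
rewrite -pi_one -(@pi_zeror _ _ _ _ _ quot_jacobson).
by rewrite -Quotient.idealrBE subr0 jacobson1.
Qed.

HB.instance Definition _ := GRing.Zmodule_isNzRing.Build quot_jacobson
  mulqA mul1q mulq1 mulqDl mulqDr nonzero1q.
HB.instance Definition _ := @isNzRingQuotient.Build
  R (Quotient.equiv jacobson) 0 -%R +%R 1 *%R quot_jacobson pi_one pi_mul.

End Jacobson.

(* Main.v *)
Require Import Defs.
From mathcomp Require Import all_boot all_order all_algebra.
From mathcomp Require Import boolp classical_sets.

Import GRing.Theory.
Local Open Scope ring_scope.

(** Write u1 = 1 + r with r in Delta(R).  If u1 + u2 = 1 + j, then r + u2 = j,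
    which is therefore a unit; this is absurd if j is in J(R).  Units of R/J(R)
    lift to units of R because 1 + J(R) consists of units, so this settles both
    R (with j = 0) and R/J(R). *)

Section JacobsonUnits.
Variable R : nzRingType.
Implicit Types (I M N : {pred R}) (x y u : R).

(** Zorn's lemma: a union of a chain of proper left ideals is again proper, since each of them
    leaves out 1. *)
Lemma maximal_left_ideal_above I :
  idealr_closed I -> exists M, maximal_left_ideal M /\ {subset I <= M}.
Proof.
move=> idI; have [I0 _ _] := idI.
(* The empty set is allowed so that the union of an empty chain qualifies. *)
pose P (A : set R) :=
  (A !=set0)%classic -> idealr_closed (mem A) /\ {subset I <= mem A}.
have [F FP Ftot|A [PA maxA]] := @Zorn_bigcup R P.
  move=> [x0 [A0 FA0 A0x0]].
  have idF A x : F A -> A x -> idealr_closed (mem A) /\ {subset I <= mem A}.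
    by move=> FA Ax; apply: (FP A FA); exists x.
  have [[A00 _ _] sIA0] := idF _ _ FA0 A0x0.
  split; last by move=> x /sIA0 /set_mem A0x; apply/mem_set; exists A0.
  split.
  - by apply/mem_set; exists A0 => //; exact: set_mem.
  - apply/negP => /set_mem [A FA A1].
    by have [[_ /negP nA1 _] _] := idF _ _ FA A1; apply: nA1; apply/mem_set.
  - move=> a u v /set_mem [A FA Au] /set_mem [B FB Bv]; apply/mem_set.
    have [AB|BA] := Ftot _ _ FA FB.
    + exists B => //; have [[_ _ Bl] _] := idF _ _ FB Bv.
      by apply: set_mem; apply: Bl; apply/mem_set => //; exact: AB.
    + exists A => //; have [[_ _ Al] _] := idF _ _ FA Au.
      by apply: set_mem; apply: Al; apply/mem_set => //; exact: BA.
have closedP N : idealr_closed N -> idealr_closed (mem [set` N]%classic).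
  move=> [N0 N1 Nl]; split.
  - exact/mem_set.
  - by apply/negP => /set_mem; exact/negP.
  - by move=> a u v /set_mem uN /set_mem vN; apply/mem_set; exact: Nl.
(* An empty [A] would not be maximal: [I] satisfies [P] and contains 0, so it is strictly larger. *)
have A0 : (A !=set0)%classic.
  apply: contrapT => nA; apply: (maxA [set` I]%classic).
    split=> [x Ax|sIA]; first by case: nA; exists x.
    by apply: nA; exists 0; exact: sIA.
  by move=> _; split; [exact: closedP|move=> x xI; apply/mem_set].
have [idA sIA] := PA A0; exists (fun x => x \in A); split=> //.
split=> // N idN sAN x xN.
(* With [x] in [N] but not in [A], [N] would be a strictly larger set satisfying [P]. *)
apply: contraT => /negP xA; case: (maxA [set` N]%classic).
  split=> [y Ay|sNA]; first by apply: sAN; apply/mem_set.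
  by apply: xA; apply/mem_set; exact: sNA.
move=> _; split; first exact: closedP.
by move=> y yI; apply/mem_set; apply: sAN; exact: sIA.
Qed.

(** If the left ideal Rx were proper, a maximal left ideal above it would contain both [x] and
    [x - 1], hence 1. *)
Lemma jacobson_left_inverse x :
  x - 1 \in @jacobson R -> exists y, y * x = 1.
Proof.
move=> /jacobsonP xJ.
pose I : {pred R} := [pred z | `[< exists y, y * x = z >]].
have [/asboolP//|I1] := boolP (1 \in I).
have idI : idealr_closed I.
  split=> //; first by apply/asboolP; exists 0; rewrite mul0r.
  move=> a _ _ /asboolP [y <-] /asboolP [z <-]; apply/asboolP.
  by exists (a * y + z); rewrite mulrDl mulrA.
have [M [maxM sIM]] := maximal_left_ideal_above I idI.
have [[M0 /negP M1 Ml] _] := maxM; case: M1.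
have xM : x \in M by apply: sIM; apply/asboolP; exists 1; rewrite mul1r.
have -> : 1 = -1 * (x - 1) + x by rewrite mulN1r opprB subrK.
by apply: Ml => //; exact: xJ.
Qed.

(** A left inverse [y] of [x] is also congruent to 1 modulo J(R), so it has a left inverse [z] in
    turn. Then z = z(yx) = (zy)x = x, and [y] is a two-sided inverse of [x]. *)
Lemma units_add1_jacobson x : x - 1 \in @jacobson R -> units R x.
Proof.
move=> xJ; have [y yx] := jacobson_left_inverse x xJ.
have yJ : y - 1 \in @jacobson R.
  have -> : y - 1 = - y * (x - 1) by rewrite mulrBr mulr1 !mulNr yx opprK addrC.
  exact: jacobsonMl.
have [z zy] := jacobson_left_inverse y yJ.
have zx : z = x by rewrite -[z]mulr1 -yx mulrA zy mul1r.
by exists y; rewrite -{1}zx.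
Qed.

Lemma units_notin_jacobson u : units R u -> u \notin @jacobson R.
Proof.
move=> [v [_ vu]]; apply/negP => /(jacobsonMl v); rewrite vu.
exact/negP/jacobson1.
Qed.

Lemma units_of_mul x y z : units R (x * y) -> units R (z * x) -> units R x.
Proof.
move=> [a [xya _]] [b [_ bzx]].
(* The right inverse [y * a] of [x] coincides with its left inverse [b * z]. *)
exists (y * a); rewrite mulrA; split=> //.
have -> : y * a = b * z.
  by rewrite -[y * a]mul1r -bzx -!mulrA [x * (y * a)]mulrA xya mulr1.
by rewrite -mulrA.
Qed.

Lemma pi_jacobson_eq x y :
  (\pi_(quot_jacobson R) x = \pi_(quot_jacobson R) y)%qT ->
  x - y \in @jacobson R.
Proof. by move=> e; rewrite Quotient.idealrBE; apply/eqP. Qed.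

(** If [v] represents the inverse class, then [x * v] and [v * x] are congruent to 1 modulo J(R),
    hence units of R. *)
Lemma units_lift_jacobson x :
  units (quot_jacobson R) (\pi_(quot_jacobson R) x)%qT -> units R x.
Proof.
move=> [v]; rewrite -[v]reprK -!rmorphM -(rmorph1 (\pi_(quot_jacobson R))%qT).
move=> [/pi_jacobson_eq xv /pi_jacobson_eq vx].
by apply: units_of_mul; apply: units_add1_jacobson; [exact: xv|exact: vx].
Qed.

Lemma DeltaU_units_add (hR : DeltaU R) u1 u2 :
  units R u1 -> units R u2 -> u1 + u2 - 1 \notin @jacobson R.
Proof.
rewrite {1}hR => -[r Dr <-] U2; apply: units_notin_jacobson.
by rewrite addrC !addrA addNr add0r; apply: Dr; exists u2.
Qed.

End JacobsonUnits.

Theorem proposition2p3 (R : nzRingType) (hR : DeltaU R) :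
  (forall u1 u2 : R, units R u1 -> units R u2 -> u1 + u2 <> 1) /\
  (forall u1 u2 : quot_jacobson R,
     units (quot_jacobson R) u1 -> units (quot_jacobson R) u2 -> u1 + u2 <> 1).
Proof.
split=> u1 u2.
  move=> U1 U2 e; have := DeltaU_units_add R hR u1 u2 U1 U2.
  by rewrite e subrr rpred0.
(* Both classes are written through representatives, which are then units of R. *)
rewrite -[u1]reprK -[u2]reprK.
move=> /units_lift_jacobson U1 /units_lift_jacobson U2.
rewrite -rmorphD -(rmorph1 (\pi_(quot_jacobson R))%qT) => /pi_jacobson_eq.
exact/negP/DeltaU_units_add.
Qed.
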